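(* Let $M_{ij,kl}=T_{ikl}T_{jkl}$ be an operation consisting of two copies of the same extremal bithermal [or thermal] tensor $T$ all of whose entries are either $0$ or $1$. Then for every product input state $\mathbf p\otimes\mathbf q$ the output state $\pi=M(\mathbf p\otimes\mathbf q)$, $\pi_{ij}=\sum_{kl}M_{ij,kl}p_kq_l$, is maximally correlated.
   Context: States are energy-incoherent, i.e. probability vectors $\mathbf p,\mathbf q$ of length $d$; Alice and Bob have the same dimension $d$ and Gibbs vector $\gamma$. A thermal tensor is $T_{ikl}\ge0$ with $\sum_iT_{ikl}=1$ for all $k,l$ whose layers preserve the Gibbs vector in one input ($\sum_kT_{ikl}\gamma_k=\gamma_i$ for all $i,l$, or $\sum_lT_{ikl}\gamma_l=\gamma_i$ for all $i,k$); it is bithermal if both conditions hold. In the zero-temperature limit the conditions are replaced by $T_{ikl}=0$ for $i>k$, respectively $i>l$ (both for bithermal). Extremal means an extreme point of the convex set of such tensors. The map $M$ acts as one round of $\mathcal S$LTOCC, whose general form is $M_{ij,kl}=T^{(A)}_{ikl}T^{(B)}_{jkl}$ with bithermal $T^{(A)},T^{(B)}$. A joint distribution $\pi$ is maximally correlated if each party's outcome determines the other's, i.e. $H(A|B)=H(B|A)=0$. *)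

(* Defs.v *)
From mathcomp Require Import all_boot all_order all_algebra.
From mathcomp Require Import all_classical all_reals all_analysis.

Set Implicit Arguments.
Unset Strict Implicit.
Unset Printing Implicit Defensive.

Import Order.TTheory GRing.Theory Num.Theory.

Local Open Scope classical_set_scope.
Local Open Scope ring_scope.

Definition is_distr (R : realType) (d : nat) (p : 'cV[R]_d) : Prop :=
  (forall i, 0 <= p i 0) /\ \sum_i p i 0 = 1.

Definition is_joint_distr (R : realType) (d : nat) (pi : 'M[R]_d) : Prop :=
  (forall i j, 0 <= pi i j) /\ \sum_i \sum_j pi i j = 1.

(* Rows are Alice's outcomes, columns are Bob's. *)
Definition product_state (R : realType) (d : nat) (p q : 'cV[R]_d) : 'M[R]_d :=
  \matrix_(k, l) (p k 0 * q l 0).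

(* H(A|B) = - sum_ij pi_ij ln (pi_ij / piB_j), in nats. Since ln 0 = 0 and
   x / 0 = 0 here, terms with pi_ij = 0 vanish, as usual. *)
Definition cond_entropy_AB (R : realType) (d : nat) (pi : 'M[R]_d) : R :=
  - \sum_i \sum_j pi i j * ln (pi i j / \sum_i' pi i' j).

Definition cond_entropy_BA (R : realType) (d : nat) (pi : 'M[R]_d) : R :=
  - \sum_i \sum_j pi i j * ln (pi i j / \sum_j' pi i j').

Definition maximally_correlated (R : realType) (d : nat) (pi : 'M[R]_d) : Prop :=
  [/\ is_joint_distr pi, cond_entropy_AB pi = 0 & cond_entropy_BA pi = 0].

(* [FiniteTemp beta E]: energies E, inverse temperature beta (beta = 0 is
   infinite temperature).
   [ZeroTemp]: the limit beta -> +oo, levels indexed by increasing energy. *)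
Inductive temperature (R : realType) (d : nat) : Type :=
| FiniteTemp of R & ('I_d -> R)
| ZeroTemp.

Definition gibbs_vector (R : realType) (d : nat) (beta : R) (E : 'I_d -> R) :
    'cV[R]_d :=
  \col_i (expR (- (beta * E i)) / \sum_j expR (- (beta * E j))).

(* Condition on a single layer L, where L i k is the weight of k -> i. *)
Definition layer_thermal (R : realType) (d : nat) (tau : temperature R d)
    (L : 'M[R]_d) : Prop :=
  match tau with
  | FiniteTemp beta E => L *m gibbs_vector beta E = gibbs_vector beta E
  | ZeroTemp => forall i k : 'I_d, (k < i)%N -> L i k = 0
  end.

(* T i k l : output i, first input k, second input l. The codomain is R^o so
   that tensors inherit the pointwise lmodType structure. *)
Definition tensor (R : realType) (d : nat) : Type := 'I_d -> 'I_d -> 'I_d -> R^o.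

Definition stochastic_tensor (R : realType) (d : nat) (T : tensor R d) : Prop :=
  (forall i k l, 0 <= T i k l) /\ (forall k l, \sum_i T i k l = 1).

Definition thermal_fst (R : realType) (d : nat) (tau : temperature R d) :
    set (tensor R d) :=
  [set T | stochastic_tensor T /\
    forall l, layer_thermal tau (\matrix_(i, k) T i k l)].

Definition thermal_snd (R : realType) (d : nat) (tau : temperature R d) :
    set (tensor R d) :=
  [set T | stochastic_tensor T /\
    forall k, layer_thermal tau (\matrix_(i, l) T i k l)].

Definition bithermal (R : realType) (d : nat) (tau : temperature R d) :
    set (tensor R d) :=
  thermal_fst tau `&` thermal_snd tau.

Definition extreme_point (R : realType) (V : lmodType R) (S : set V) (x : V) :
    Prop :=
  S x /\ forall (y z : V) (t : R), S y -> S z -> 0 < t < 1 ->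
    x = t *: y + (1 - t) *: z -> y = x /\ z = x.

Definition zero_one_tensor (R : realType) (d : nat) (T : tensor R d) : Prop :=
  forall i k l, T i k l = 0 \/ T i k l = 1.

(* M_{ij,kl}, written M i j k l. *)
Definition sltocc_round (R : realType) (d : nat) (TA TB : tensor R d) :
    'I_d -> 'I_d -> 'I_d -> 'I_d -> R :=
  fun i j k l => TA i k l * TB j k l.

Definition apply_joint (R : realType) (d : nat)
    (M : 'I_d -> 'I_d -> 'I_d -> 'I_d -> R) (rho : 'M[R]_d) : 'M[R]_d :=
  \matrix_(i, j) \sum_k \sum_l M i j k l * rho k l.

(* Main.v *)
Require Import Defs.
From mathcomp Require Import all_boot all_order all_algebra.
From mathcomp Require Import all_classical all_reals all_analysis.

(** Every input pair (k, l) is sent by a 0/1 stochastic tensor to a single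
    outcome, so two copies of the tensor always return equal outcomes: the output
    distribution is diagonal, and each party's outcome determines the other's. *)

Import Order.TTheory GRing.Theory Num.Theory.

Local Open Scope ring_scope.

Lemma extreme_point_stochastic (R : realType) (d : nat) (tau : temperature R d)
    (T : tensor R d) :
  extreme_point (bithermal tau) T \/
  extreme_point (thermal_fst tau) T \/
  extreme_point (thermal_snd tau) T -> stochastic_tensor T.
Proof. by case=> [[[[]]]|[[[]]|[[]]]]. Qed.

(** If [T i k l] is 1, it already exhausts the unit sum over outputs for the input pair [(k, l)], so
    nonnegativity forces every other entry there to vanish. *)
Lemma zero_one_tensorM (R : realType) (d : nat) (T : tensor R d)
    (i j k l : 'I_d) :
  stochastic_tensor T -> zero_one_tensor T -> i != j -> T i k l * T j k l = 0.
Proof.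
move=> [T0 T1] h01 ij.
case: (h01 i k l) => [->|Ti]; first by rewrite mul0r.
have := T1 k l; rewrite (bigD1 i) //= Ti => /eqP.
rewrite -subr_eq0 addrAC subrr add0r psumr_eq0 // => /allP/(_ j).
by rewrite mem_index_enum eq_sym ij => /(_ isT)/eqP ->; rewrite mulr0.
Qed.

Lemma is_joint_distr_product_state (R : realType) (d : nat) (p q : 'cV[R]_d) :
  is_distr p -> is_distr q -> is_joint_distr (product_state p q).
Proof.
move=> [p0 p1] [q0 q1]; split=> [i j|]; first by rewrite mxE mulr_ge0.
rewrite -p1; apply: eq_bigr => i _.
by under eq_bigr do rewrite mxE; rewrite -mulr_sumr q1 mulr1.
Qed.

(** Given [(k, l)] the two outputs are independent, so summing over both factors into two unit sums
    and leaves the total mass of [rho]. *)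
Lemma is_joint_distr_sltocc_round (R : realType) (d : nat) (TA TB : tensor R d)
    (rho : 'M[R]_d) :
  stochastic_tensor TA -> stochastic_tensor TB -> is_joint_distr rho ->
  is_joint_distr (apply_joint (sltocc_round TA TB) rho).
Proof.
move=> [A0 A1] [B0 B1] [r0 r1]; split=> [i j|].
  by rewrite mxE; apply: sumr_ge0 => k _; apply: sumr_ge0 => l _; rewrite !mulr_ge0.
(* The input sums over [k] and [l] are moved outside the output sums over [i] and [j]. *)
transitivity (\sum_k \sum_l (\sum_i TA i k l) * (\sum_j TB j k l) * rho k l).
  under eq_bigr => i _ do under eq_bigr => j _ do rewrite mxE.
  under eq_bigr => i _ do rewrite exchange_big.
  rewrite exchange_big; apply: eq_bigr => k _.
  under eq_bigr => i _ do rewrite exchange_big.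
  rewrite exchange_big; apply: eq_bigr => l _.
  rewrite mulr_suml mulr_suml; apply: eq_bigr => i _.
  by rewrite mulr_sumr mulr_suml.
rewrite -r1; apply: eq_bigr => k _; apply: eq_bigr => l _.
by rewrite A1 B1 !mul1r.
Qed.

(** An entropy term whose joint weight equals its marginal; at [x = 0] the outer factor kills it,
    otherwise [ln 1] does. *)
Lemma mulr_ln_divff (R : realType) (x : R) : x * ln (x / x) = 0.
Proof.
by have [->|x0] := eqVneq x 0; rewrite ?mul0r // divff // ln1 mulr0.
Qed.

Lemma diag_maximally_correlated (R : realType) (d : nat) (pi : 'M[R]_d) :
  is_joint_distr pi -> (forall i j, i != j -> pi i j = 0) ->
  maximally_correlated pi.
Proof.
move=> hpi diag; split=> //.
- rewrite /cond_entropy_AB big1 ?oppr0 // => i _; rewrite big1 // => j _.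
  have [->|ij] := eqVneq i j; last by rewrite diag ?mul0r.
  (* Bob's marginal at [j] collapses to the diagonal entry, so the conditional probability is
     [x / x]. *)
  rewrite (bigD1 j) //= big1 ?addr0 ?mulr_ln_divff // => i' i'j.
  by rewrite diag.
- rewrite /cond_entropy_BA big1 ?oppr0 // => i _; rewrite big1 // => j _.
  have [->|ij] := eqVneq i j; last by rewrite diag ?mul0r.
  rewrite (bigD1 j) //= big1 ?addr0 ?mulr_ln_divff // => j' j'j.
  by rewrite diag // eq_sym.
Qed.

Theorem mainTheorem13 (R : realType) (d : nat) (tau : temperature R d)
    (T : tensor R d)
    (hT : extreme_point (bithermal tau) T \/
          extreme_point (thermal_fst tau) T \/
          extreme_point (thermal_snd tau) T)
    (h01 : zero_one_tensor T)
    (p q : 'cV[R]_d) (hp : is_distr p) (hq : is_distr q) :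
  maximally_correlated (apply_joint (sltocc_round T T) (product_state p q)).
Proof.
have sT := extreme_point_stochastic _ _ _ _ hT.
apply: diag_maximally_correlated.
  exact/is_joint_distr_sltocc_round/is_joint_distr_product_state.
(* Off the diagonal, the contribution of each input pair vanishes separately. *)
move=> i j ij; rewrite mxE big1 // => k _; rewrite big1 // => l _.
by rewrite /sltocc_round zero_one_tensorM ?mul0r.
Qed.
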